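(* Let $(A,B)$ be controllable, and let $\tilde x_{[0,T-1]}$ be the state signal of $\tilde x(t+1)=A\tilde x(t)+Bu(t)+w(t)$ ($t=0,\dots,T-2$) driven by the control input $u_{[0,T-1]}$ and disturbance process $w_{[-1,T-2]}$, both persistently exciting of order $n+L$. Let $\hat{\mathcal{G}}\in\mathcal{L}_{TV}^{L,(T-L+1)\times n}$ be any causal (block-lower-triangular) operator whose block-diagonal elements satisfy $\hat G(i,i)\in\Gamma(\tilde x)$ for $i=0,1,\dots,L-1$, and whose off-diagonal blocks satisfy $\mathcal{H}_1(\tilde x)\hat G(i,j)=0$ for $i\ne j$. Define $$\hat{\mathbf{\Phi}}_x=\mathcal{Z}_L(I_L\otimes\mathcal{H}_L(\tilde x))\hat{\mathcal{G}},\qquad \hat{\mathbf{\Phi}}_u=\mathcal{Z}_L(I_L\otimes\mathcal{H}_L(u))\hat{\mathcal{G}},\qquad \mathbf{\Delta}=\mathcal{Z}_L(I_L\otimes\mathcal{Z}\mathcal{H}_L(w))\hat{\mathcal{G}}.$$ Then $\mathbf{\Delta}$ is strictly causal (strictly block-lower-triangular), $\hat{\mathbf{\Phi}}_x\in\mathcal{L}_{TV}^{L,n\times n}$, $\hat{\mathbf{\Phi}}_u\in\mathcal{L}_{TV}^{L,m\times n}$, and $$\begin{bmatrix} I-\mathcal{Z}\mathcal{A} & -\mathcal{Z}\mathcal{B}\end{bmatrix}\begin{bmatrix}\hat{\mathbf{\Phi}}_x\\ \hat{\mathbf{\Phi}}_u\end{bmatrix}=I+\mathbf{\Delta}.$$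
   Context: Here $A\in\mathbb{R}^{n\times n}$, $B\in\mathbb{R}^{n\times m}$, $L>0$ is the control horizon and $T$ the data length. By convention $w(-1)=\tilde x(0)$, and this initial condition is set to $0$. $\mathcal{L}_{TV}^{L,p\times q}$ is the set of linear causal operators over horizon $L$, i.e. $L\times L$ block-lower-triangular matrices $\mathbf{R}$ with blocks $R(i,j)\in\mathbb{R}^{p\times q}$, $0\le i,j\le L-1$, $R(i,j)=0$ for $i<j$. Hankel matrices: for $\sigma_{[0,T-1]}$ with $\sigma(t)\in\mathbb{R}^p$, $\mathcal{H}_L(\sigma)\in\mathbb{R}^{pL\times(T-L+1)}$ has $(k,t)$ block $\sigma(t+k)$ for $0\le k\le L-1$, $0\le t\le T-L$. The same convention is used for $\mathcal{H}_L(w)$: its $(k,t)$ block is $w(t+k)$ (the only entry beyond $w(T-2)$, namely $w(T-1)$, lies in the last block row and is annihilated by $\mathcal{Z}$, so its value is irrelevant). $\mathcal{H}_1(\tilde x)=[\tilde x(0)\ \cdots\ \tilde x(T-L)]$ is the first block row of $\mathcal{H}_L(\tilde x)$. $\Gamma(\tilde x)=\{G\in\mathbb{R}^{(T-L+1)\times n}:\mathcal{H}_1(\tilde x)G=I_n\}$. A length-$T$ signal in $\mathbb{R}^p$ is persistently exciting of order $K$ if its Hankel matrix of order $K$ has full rank, where $T\ge(p+1)K-1$ is assumed (so full row rank). $\mathcal{A}=I_L\otimes A$, $\mathcal{B}=I_L\otimes B$. $\mathcal{Z}$ is the block-downshift operator ($L\times L$ blocks, identity blocks on the first block subdiagonal,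 zeros elsewhere), with block size $n$ or $m$ as dictated by dimensions, and $\mathcal{Z}_L=[\,I\ \ \mathcal{Z}\ \ \cdots\ \ \mathcal{Z}^{L-1}\,]$ (again with block size $n$ in $\hat{\mathbf{\Phi}}_x,\mathbf{\Delta}$ and block size $m$ in $\hat{\mathbf{\Phi}}_u$). *)

(* Defs.v *)
From mathcomp Require Import all_boot all_order all_algebra.
From mathcomp Require Import reals.
Set Implicit Arguments.
Unset Strict Implicit.
Unset Printing Implicit Defensive.
Import Order.TTheory GRing.Theory Num.Theory.
Local Open Scope ring_scope.

Section Defs.
Context {R : realType}.

(* An L x L' block matrix with p x q blocks has type
   'M_(\sum_(i < L) p, \sum_(j < L') q); submxblock extracts its blocks. *)

Definition kron L L' p q (S : 'M[R]_(L, L')) (M : 'M[R]_(p, q)) :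
    'M[R]_(\sum_(i < L) p, \sum_(j < L') q) :=
  \mxblock_(i < L, j < L') (S i j *: M).

Definition downshift L p : 'M[R]_(\sum_(i < L) p) :=
  \mxblock_(i < L, j < L) ((i == j.+1 :> nat)%:R%:M : 'M[R]_p).

Definition downshift_row L p :
    'M[R]_(\sum_(i < L) p, \sum_(j < L) \sum_(i < L) p) :=
  \mxrow_(j < L) (downshift L p ^+ j).

Definition causal L p q (M : 'M[R]_(\sum_(i < L) p, \sum_(j < L) q)) : Prop :=
  forall i j : 'I_L, (i < j)%N -> submxblock M i j = 0.

Definition strictly_causal L p q
    (M : 'M[R]_(\sum_(i < L) p, \sum_(j < L) q)) : Prop :=
  forall i j : 'I_L, (i <= j)%N -> submxblock M i j = 0.

(* A finite signal s_[a, a + T - 1] is a function on int together with a and T;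
   its values outside the window [a, a + T - 1] carry no meaning. The number
   T - K + 1 of Hankel columns is written T.+1 - K, so that the truncated
   subtraction gives no column at all when T < K. *)

Definition hankel_row p (a : int) (T K : nat) (s : int -> 'cV[R]_p) (k : nat) :
    'M[R]_(p, T.+1 - K) :=
  \matrix_(i, t) s (a + (t + k)%N%:Z) i 0.

Definition hankel p (a : int) (T K : nat) (s : int -> 'cV[R]_p) :
    'M[R]_(\sum_(k < K) p, T.+1 - K) :=
  \mxcol_(k < K) hankel_row a T K s k.

Definition persistently_exciting p (a : int) (T K : nat)
    (s : int -> 'cV[R]_p) : Prop :=
  ((p.+1 * K).-1 <= T)%N /\ row_free (hankel a T K s).

(* Every state can be steered to every other state in finite time. *)
Definition controllable n m (A : 'M[R]_n) (B : 'M[R]_(n, m)) : Prop :=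
  forall x0 xf : 'cV[R]_n,
  exists (N : nat) (x : nat -> 'cV[R]_n) (u : nat -> 'cV[R]_m),
    [/\ x 0%N = x0,
        forall t, (t < N)%N -> x t.+1 = A *m x t + B *m u t
      & x N = xf].

(* H_1 of the state: the first block row x(0), ..., x(T - L) of H_L(x), which
   has T - L + 1 columns rather than the T columns of [hankel 0 T 1 x]. *)
Definition hankel1 n (T L : nat) (x : int -> 'cV[R]_n) :
    'M[R]_(n, T.+1 - L) := hankel_row 0 T L x 0.

Definition Gamma n (T L : nat) (x : int -> 'cV[R]_n)
    (G : 'M[R]_(T.+1 - L, n)) : Prop :=
  hankel1 T L x *m G = 1%:M.

End Defs.

(* Main.v *)
Require Import Defs.
From mathcomp Require Import all_boot all_order all_algebra.
From mathcomp Require Import reals.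
Set Implicit Arguments.
Unset Strict Implicit.
Unset Printing Implicit Defensive.
Import Order.TTheory GRing.Theory Num.Theory.
Local Open Scope ring_scope.

(** Write [G_k] for the k-th block row of [G].  The operator [Z_L (I (x) M) G]
sends a block column [M = (M_0, ..., M_(L-1))] to [sum_k Z^k M G_k]: it is the
convolution of the impulse response [M] with the rows of [G], and its (i, j)
block is [sum_(k <= i) M_(i-k) G(k, j)].  Three facts about this operator,
called [convolution M G] below, give the theorem.

- It preserves causality, since no [k] satisfies [k <= i < j] and
  [G(k, j) <> 0]; if moreover [M_0 = 0], the diagonal term [M_0 G(i, i)]
  disappears as well and the result is strictly causal.  The latter applies to
  [Delta], because a downshifted column starts with a zero block.
- It is additive in [M], and it commutes with every [S (x) D] such that [S]
  commutes with the scalar shift, hence with [Z (I (x) A)] and [Z (I (x) B)].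
  So [(I - Z calA) Phix - Z calB Phiu] is the convolution of
  [H(x) - Z calA H(x) - Z calB H(u)] with [G].
- The dynamics, read along the columns of the Hankel matrices, say that this
  last block column is [E_0 H_1(x) + Z H(w)], where [E_0] is the first block
  unit column.  Convolving [Z H(w)] gives [Delta], and convolving
  [E_0 H_1(x)] gives the matrix with blocks [H_1(x) G(i, j)], which is the
  identity by the hypotheses on [G]. *)

(** * Kronecker products and the shift *)

Lemma mul_kron (R : realType) L1 L2 L3 p q r (S : 'M[R]_(L1, L2))
    (S' : 'M[R]_(L2, L3)) (M : 'M[R]_(p, q)) (M' : 'M[R]_(q, r)) :
  kron S M *m kron S' M' = kron (S *m S') (M *m M').
Proof.
rewrite /kron mul_mxblock; apply: eq_mxblock => i j.
rewrite mxE scaler_suml; apply: eq_bigr => k _.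
by rewrite -scalemxAl -scalemxAr scalerA.
Qed.

Lemma kron_mul_mxcol (R : realType) L1 L2 p q r (S : 'M[R]_(L1, L2))
    (M : 'M[R]_(p, q)) (F : 'I_L2 -> 'M[R]_(q, r)) :
  kron S M *m \mxcol_k F k = \mxcol_i \sum_k S i k *: (M *m F k).
Proof.
rewrite /kron mul_mxblock_mxrow; apply: eq_mxcol => i.
by apply: eq_bigr => k _; rewrite -scalemxAl.
Qed.

Lemma kron1_mul_mxcol (R : realType) L p q r (M : 'M[R]_(p, q))
    (F : 'I_L -> 'M[R]_(q, r)) :
  kron (1%:M : 'M_L) M *m \mxcol_k F k = \mxcol_k (M *m F k).
Proof.
rewrite kron_mul_mxcol; apply: eq_mxcol => i.
rewrite (bigD1 i) //= big1 => [|k ki].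
  by rewrite !mxE eqxx scale1r addr0.
by rewrite !mxE eq_sym (negPf ki) scale0r.
Qed.

Lemma kron11 (R : realType) L p :
  kron (1%:M : 'M[R]_L) (1%:M : 'M[R]_p) = 1%:M.
Proof.
apply/mxblockP => i j; rewrite mxblockK -mxdiagZ mxblockK mxE.
case: eqP => _; first by rewrite scale1r conform_mx_id.
by rewrite scale0r.
Qed.

(** The shift with scalar blocks: [downshift L p] is its Kronecker product with
the identity, which reduces all shift computations to size [L]. *)
Definition subdiag (R : realType) L : 'M[R]_L :=
  \matrix_(i, j) (i == j.+1 :> nat)%:R.

Lemma downshiftE (R : realType) L p :
  downshift L p = kron (subdiag R L) (1%:M : 'M[R]_p).
Proof.
by apply: eq_mxblock => i j; rewrite mxE scale_scalar_mx mulr1.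
Qed.

Lemma subdiag_mulE (R : realType) L q (S : 'M[R]_(L, q)) i j :
  (subdiag R L *m S) i j = \sum_(k < L | i == k.+1 :> nat) S k j.
Proof.
rewrite mxE [RHS]big_mkcond; apply: eq_bigr => k _; rewrite mxE.
by case: eqP => _; rewrite ?mul1r ?mul0r.
Qed.

Lemma subdiag_expE (R : realType) L k (i j : 'I_L) :
  (subdiag R L ^+ k) i j = (i == j + k :> nat)%N%:R.
Proof.
elim: k i j => [|k IHk] i j; first by rewrite expr0 mxE addn0.
rewrite exprS -mulmxE subdiag_mulE.
under eq_bigr do rewrite IHk.
case: i => [[|i] /= ltiL].
  by rewrite big_pred0 // addnS.
rewrite (big_pred1 (Ordinal (ltnW ltiL))) => [|l] /=.
  by rewrite addnS eqSS.
by rewrite eqSS eq_sym.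
Qed.

Lemma downshift_expE (R : realType) L p k :
  (downshift L p : 'M[R]_(\sum_(i < L) p)) ^+ k
    = kron (subdiag R L ^+ k) (1%:M : 'M[R]_p).
Proof.
elim: k => [|k IHk]; first by rewrite !expr0 kron11.
by rewrite !exprS -!mulmxE IHk downshiftE mul_kron mul1mx.
Qed.

Lemma kron_subdiag_exp_mxcol (R : realType) L p q r k (D : 'M[R]_(p, q))
    (F : nat -> 'M[R]_(q, r)) :
  kron (subdiag R L ^+ k) D *m \mxcol_(l < L) F l
    = \mxcol_(i < L) (if (k <= i)%N then D *m F (i - k)%N else 0).
Proof.
rewrite kron_mul_mxcol; apply: eq_mxcol => i; case: leqP => [leki|ltik].
  rewrite (bigD1 (Ordinal (leq_ltn_trans (leq_subr k i) (ltn_ord i)))) //=.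
  rewrite big1 => [|l].
    by rewrite subdiag_expE subnK // eqxx scale1r addr0.
  rewrite -val_eqE /= subdiag_expE => lik.
  by case: eqP => [ilk|]; rewrite ?scale0r // ilk addnK eqxx in lik *.
rewrite big1 // => l _.
by rewrite subdiag_expE (ltn_eqF (leq_trans ltik (leq_addl _ _))) scale0r.
Qed.

Lemma kron_subdiag_mxcol (R : realType) L p q r (D : 'M[R]_(p, q))
    (F : nat -> 'M[R]_(q, r)) :
  kron (subdiag R L) D *m \mxcol_(k < L) F k
    = \mxcol_(i < L) (if (i : nat) is k.+1 then D *m F k else 0).
Proof.
rewrite -[subdiag R L]expr1 kron_subdiag_exp_mxcol.
by apply: eq_mxcol => -[[|i] /= ltiL]; rewrite ?subn1.
Qed.

(** * Convolution with a causal operator *)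

Definition convolution (R : realType) L p q r (M : 'M[R]_(\sum_(k < L) p, q))
    (G : 'M[R]_(\sum_(k < L) q, r)) : 'M[R]_(\sum_(k < L) p, r) :=
  downshift_row L p *m kron (1%:M : 'M_L) M *m G.

Section Convolution.
Variables (R : realType) (L q : nat).
Implicit Types (p r : nat).

Lemma convolutionE p r (M : 'M[R]_(\sum_(k < L) p, q))
    (G : 'M[R]_(\sum_(k < L) q, r)) :
  convolution M G = \sum_(k < L) downshift L p ^+ k *m (M *m submxcol G k).
Proof.
rewrite /convolution -mulmxA -{1}[G]submxcolK kron1_mul_mxcol.
by rewrite /downshift_row mul_mxrow_mxcol.
Qed.

Lemma convolutionD p r (M N : 'M[R]_(\sum_(k < L) p, q))
    (G : 'M[R]_(\sum_(k < L) q, r)) :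
  convolution (M + N) G = convolution M G + convolution N G.
Proof.
rewrite !convolutionE -big_split; apply: eq_bigr => k _ /=.
by rewrite mulmxDl mulmxDr.
Qed.

Lemma convolutionB p r (M N : 'M[R]_(\sum_(k < L) p, q))
    (G : 'M[R]_(\sum_(k < L) q, r)) :
  convolution (M - N) G = convolution M G - convolution N G.
Proof. by apply: (addIr (convolution N G)); rewrite -convolutionD !subrK. Qed.

(** Convolution commutes with the operators that are shift-invariant and act
in the same way at every time step; [D] may change the block size. *)
Lemma mul_kron_convolution p p' r (S : 'M[R]_L) (D : 'M[R]_(p', p))
    (M : 'M[R]_(\sum_(k < L) p, q)) (G : 'M[R]_(\sum_(k < L) q, r)) :
  GRing.comm S (subdiag R L) ->
  kron S D *m convolution M G = convolution (kron S D *m M) G.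
Proof.
move=> SZ; rewrite !convolutionE mulmx_sumr; apply: eq_bigr => k _.
rewrite !downshift_expE !mulmxA !mul_kron mulmx1 mul1mx.
by have := commrX k SZ; rewrite /GRing.comm -!mulmxE => ->.
Qed.

Lemma submxblock_convolution p r (F : nat -> 'M[R]_(p, q))
    (G : 'M[R]_(\sum_(k < L) q, \sum_(k < L) r)) (i j : 'I_L) :
  submxblock (convolution (\mxcol_(k < L) F k) G) i j
    = \sum_(k < L | (k <= i)%N) F (i - k)%N *m submxblock G k j.
Proof.
rewrite convolutionE submxblock_sum [RHS]big_mkcond; apply: eq_bigr => k _ /=.
rewrite downshift_expE mxcol_mul.
rewrite (kron_subdiag_exp_mxcol _ _ _ (fun l => F l *m submxcol G k)).
rewrite submxblockEv mxcolK; case: leqP => _; last exact: submxrow0.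
by rewrite mul1mx -mul_submxrow -submxblockEv.
Qed.

Lemma causal_convolution p r (F : nat -> 'M[R]_(p, q))
    (G : 'M[R]_(\sum_(k < L) q, \sum_(k < L) r)) :
  causal G -> causal (convolution (\mxcol_(k < L) F k) G).
Proof.
move=> hG i j ltij; rewrite submxblock_convolution big1 // => k leki.
by rewrite hG ?mulmx0 // (leq_ltn_trans leki).
Qed.

Lemma strictly_causal_convolution p r (F : nat -> 'M[R]_(p, q))
    (G : 'M[R]_(\sum_(k < L) q, \sum_(k < L) r)) :
  F 0%N = 0 -> causal G ->
  strictly_causal (convolution (\mxcol_(k < L) F k) G).
Proof.
move=> F0 hG i j leij; rewrite submxblock_convolution big1 // => k leki.
have [ltkj|lejk] := ltnP k j; first by rewrite hG ?mulmx0.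
(* The three indices coincide: this is the diagonal term. *)
have -> : (i - k = 0)%N by apply/eqP; rewrite subn_eq0 (leq_trans leij).
by rewrite F0 mul0mx.
Qed.

Lemma submxblock_convolution_impulse p r (H : 'M[R]_(p, q))
    (G : 'M[R]_(\sum_(k < L) q, \sum_(k < L) r)) (i j : 'I_L) :
  submxblock
      (convolution (\mxcol_(k < L) (if (k : nat) is 0%N then H else 0)) G) i j
    = H *m submxblock G i j.
Proof.
rewrite (submxblock_convolution (fun k => if k is 0%N then H else 0)).
rewrite (bigD1 i) //= subnn big1 ?addr0 // => k /andP[leki neki].
have : (0 < i - k)%N by rewrite subn_gt0 ltn_neqAle neki leki.
by case: (i - k)%N => // d _; rewrite mul0mx.
Qed.

End Convolution.

(** * The dynamics along Hankel matrices *)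

(** A column of the Hankel matrices is a window of length [L] of the
trajectory: the first block is its initial state, and each later block follows
from the preceding one by the state equation.  The last sample reached is
[x (T - 1)], so only the steps covered by [hdyn] occur. *)
Lemma hankel_dynamics (R : realType) (n m L T : nat) (A : 'M[R]_n)
    (B : 'M[R]_(n, m)) (x w : int -> 'cV[R]_n) (u : int -> 'cV[R]_m)
    (hdyn : forall t : nat, (t.+1 < T)%N ->
       x t.+1%:Z = A *m x t%:Z + B *m u t%:Z + w t%:Z) :
  hankel 0 T L x - kron (subdiag R L) A *m hankel 0 T L x
      - kron (subdiag R L) B *m hankel 0 T L u
    = \mxcol_(k < L) (if (k : nat) is 0%N then hankel1 T L x else 0)
      + downshift L n *m hankel 0 T L w.
Proof.
rewrite downshiftE /hankel !kron_subdiag_mxcol -!mxcolB -mxcolD.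
apply: eq_mxcol => -[[|k] /= ltkL]; first by rewrite !subr0 addr0.
suff -> : hankel_row 0 T L x k.+1 = A *m hankel_row 0 T L x k
    + B *m hankel_row 0 T L u k + hankel_row 0 T L w k.
  by rewrite mul1mx add0r -addrA -opprD addrC addKr.
apply/matrixP => i t.
have lttkT : ((t + k).+1 < T)%N.
  have := ltn_ord t; rewrite ltn_subRL addnC => lttLT.
  by rewrite -ltnS (leq_trans _ lttLT) // ltnS -!addnS leq_add2l.
rewrite !mxE !add0r addnS hdyn // !mxE.
by congr (_ + _ + _); apply: eq_bigr => a _; rewrite !mxE add0r.
Qed.

(** * The closed-loop responses built from data *)

Theorem theorem4 (R : realType) (n m L T : nat)
    (A : 'M[R]_n) (B : 'M[R]_(n, m))
    (x w : int -> 'cV[R]_n) (u : int -> 'cV[R]_m)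
    (G : 'M[R]_(\sum_(i < L) (T.+1 - L)%N, \sum_(j < L) n))
    (hL : (0 < L)%N)
    (hAB : controllable A B)
    (hw0 : w (-1) = x 0)
    (hx0 : x 0 = 0)
    (hdyn : forall t : nat, (t.+1 < T)%N ->
       x t.+1%:Z = A *m x t%:Z + B *m u t%:Z + w t%:Z)
    (hu : persistently_exciting 0 T (n + L) u)
    (hw : persistently_exciting (-1) T (n + L) w)
    (hG : causal G)
    (hGdiag : forall i : 'I_L, Gamma x (submxblock G i i))
    (hGoff : forall i j : 'I_L, i != j ->
       hankel1 T L x *m submxblock G i j = 0) :
  let Phix := downshift_row L n *m kron (1%:M : 'M_L) (hankel 0 T L x) *m G in
  let Phiu := downshift_row L m *m kron (1%:M : 'M_L) (hankel 0 T L u) *m G in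
  let Delta := downshift_row L n
    *m kron (1%:M : 'M_L) (downshift L n *m hankel 0 T L w) *m G in
  let calA := kron (1%:M : 'M_L) A in
  let calB := kron (1%:M : 'M_L) B in
  [/\ strictly_causal Delta,
      causal Phix,
      causal Phiu
    & row_mx (1%:M - downshift L n *m calA) (- (downshift L n *m calB))
        *m col_mx Phix Phiu = 1%:M + Delta].
Proof.
move=> Phix Phiu Delta calA calB; split.
- rewrite /Delta downshiftE /hankel kron_subdiag_mxcol.
  by apply: (strictly_causal_convolution
    (F := fun i => if i is k.+1 then 1%:M *m hankel_row 0 T L w k else 0)).
- exact: causal_convolution hG.
- exact: causal_convolution hG.
rewrite mul_row_col mulmxBl mul1mx mulNmx /calA /calB downshiftE !mul_kron.
rewrite !mulmx1 !mul1mx -!/(convolution _ _) !mul_kron_convolution //.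
rewrite -!convolutionB (hankel_dynamics _ hdyn) convolutionD; congr (_ + _).
apply/mxblockP => i j; rewrite submxblock_convolution_impulse -mxdiagZ mxblockK.
have [<-|/hGoff //] := eqVneq i j.
by rewrite conform_mx_id; apply: hGdiag.
Qed.
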